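(* Let $L$ be a non-trivial compactly generated multiplicative lattice in which the top element $1$ is compact and every finite product of compact elements is compact. Then $L$ contains a minimal $z$-prime element, i.e. an element that is minimal (with respect to $\leqslant$) in the set of all $z$-prime elements of $L$.
   Context: A multiplicative lattice is a complete lattice $(L,\leqslant,0,1)$ endowed with an associative, commutative multiplication which distributes over arbitrary joins and has $1$ as multiplicative identity; it is non-trivial if $0\neq 1$. An element $c\in L$ is compact if for any $\{x_\lambda\}_{\lambda\in\Lambda}\subseteq L$, $c\leqslant\bigvee_{\lambda\in\Lambda}x_\lambda$ implies $c\leqslant\bigvee_{i=1}^n x_{\lambda_i}$ for some $n\in\mathbb{N}^+$ and $\lambda_1,\dots,\lambda_n\in\Lambda$; $L$ is compactly generated if every element of $L$ is a join of compact elements. An element $x$ is proper if $x\neq 1$. A proper element $m$ is maximal if $m\leqslant x$ and $x<1$ imply $m=x$, for all $x\in L$; $\mathcal{M}(L)$ is the set of maximal elements. For $a\in L$ put $\mathcal{M}_a=\{m\in\mathcal{M}(L)\mid a\leqslant m\}$. An element $x\in L$ is a $z$-element if for all $a,b\in L$, $\mathcal{M}_a=\mathcal{M}_b$ and $b\leqslant x$ imply $a\leqslant x$. A proper $z$-element $p$ is $z$-prime if for all $z$-elements $a,b$ of $L$, $ab\leqslant p$ implies $a\leqslant p$ or $b\leqslant p$. *)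

(* Defs.v *)
From HB Require Import structures.
From mathcomp Require Import all_boot all_order.
From mathcomp Require Import classical_sets.

Set Implicit Arguments.
Unset Strict Implicit.
Unset Printing Implicit Defensive.

Import Order.TTheory.

Local Open Scope classical_set_scope.
Local Open Scope order_scope.

HB.mixin Record isCompleteLattice (d : Order.disp_t) L of Order.TBLattice d L := {
  sup : set L -> L;
  sup_isLub : forall A : set L, isLub A (sup A)
}.

#[short(type="completeLatticeType")]
HB.structure Definition CompleteLattice (d : Order.disp_t) :=
  { L of Order.TBLattice d L & isCompleteLattice d L }.

(* The elements 0 and 1 of the lattice are \bot and \top. Taking A = set0 in
   mul_supr gives x * \bot = \bot. *)
HB.mixin Record isMultLattice (d : Order.disp_t) L of CompleteLattice d L := {
  mul : L -> L -> L;
  mulA : associative mul;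
  mulC : commutative mul;
  mul1 : left_id \top mul;
  mul_supr : forall (x : L) (A : set L), mul x (sup A) = sup (mul x @` A)
}.

#[short(type="multLatticeType")]
HB.structure Definition MultLattice (d : Order.disp_t) :=
  { L of CompleteLattice d L & isMultLattice d L }.

Declare Scope mult_lattice_scope.
Delimit Scope mult_lattice_scope with ML.
Notation "x * y" := (mul x y) : mult_lattice_scope.
Notation "\prod_ ( i <- s ) F" := (\big[mul / \top]_(i <- s) F) : mult_lattice_scope.

HB.instance Definition _ (d : Order.disp_t) (L : multLatticeType d) :=
  Monoid.isComLaw.Build L \top (@mul d L) (@mulA d L) (@mulC d L) (@mul1 d L).

Local Open Scope mult_lattice_scope.

Section Elements.
Context (d : Order.disp_t) (L : multLatticeType d).
Implicit Types (a b c m p x : L).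

(* Families are indexed by nonempty sets: a finite subfamily has at least one
   member, so without A !=set0 the element \bot would never be compact. *)
Definition compact_element c : Prop :=
  forall A : set L, A !=set0 -> c <= sup A ->
    exists s : seq L, [/\ s != [::], [set` s] `<=` A & c <= \join_(x <- s) x].

Definition proper_element x : Prop := x != \top.

Definition maximal_element m : Prop :=
  proper_element m /\ forall x, m <= x -> x < \top -> m = x.

Definition maximals_above a : set L := [set m | maximal_element m /\ a <= m].

Definition z_element x : Prop :=
  forall a b, maximals_above a = maximals_above b -> b <= x -> a <= x.

Definition z_prime p : Prop :=
  [/\ proper_element p, z_element p &
      forall a b, z_element a -> z_element b -> a * b <= p -> a <= p \/ b <= p].

Definition minimal_z_prime p : Prop :=
  z_prime p /\ forall q : L, z_prime q -> q <= p -> q = p.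

End Elements.

Definition compactly_generated (d : Order.disp_t) (L : multLatticeType d) : Prop :=
  forall x : L, exists2 A : set L, A `<=` @compact_element d L & x = sup A.

(* Main.v *)
Require Import Defs.
From mathcomp Require Import all_boot all_order.
From mathcomp Require Import classical_sets boolp.

(** Two applications of Zorn's lemma. Since [\top] is compact, a chain of proper
    elements has a proper join, so a maximal element exists; maximal elements
    are z-prime, so the set of z-prime elements is nonempty. It is closed under
    meets of nonempty chains: if [a] and [b] avoid members [p] and [q] of the
    chain, both avoid the smaller of the two, hence [a * b] does too. *)

Import Order.TTheory.

Local Open Scope classical_set_scope.
Local Open Scope order_scope.
Local Open Scope mult_lattice_scope.

(** Apply [Zorn] to the subtype of elements of [P]. The point of [P] bounds the empty chain, so
    upper bounds are asked for nonempty chains only. *)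
Lemma Zorn_in {T : Type} {R : rel T} {P : set T} :
  P !=set0 -> reflexive R -> transitive R -> antisymmetric R ->
  (forall A : set T, A !=set0 -> A `<=` P -> total_on A R ->
     exists2 t, P t & forall s, A s -> R s t) ->
  exists2 t, P t & forall s, P s -> R t s -> s = t.
Proof.
move=> [x0 Px0] Rxx Rtr Ranti bnd.
have [||u v uv vu|B Btot|[t Pt] tmax] := @Zorn {x | P x} (fun u v => R (sval u) (sval v)).
- by move=> u; exact: Rxx.
- by move=> u v w; exact: Rtr.
- by case: u v uv vu => u Pu [v Pv] /= uv vu; apply: eq_exist; apply: Ranti; rewrite uv vu.
- have [->|/set0P[u Bu]] := eqVneq B set0; first by exists (exist P x0 Px0).
  have [||_ _ [v Bv <-] [w Bw <-]|t Pt tub] := bnd (sval @` B).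
  + by exists (sval u), u.
  + by move=> _ [v _ <-]; exact: svalP.
  + exact: Btot.
  + by exists (exist P t Pt) => v Bv; apply: tub; exists v.
by exists t => // s Ps /(tmax (exist P s Ps))/(congr1 sval).
Qed.

Section CompleteLattices.
Context {d : Order.disp_t} {L : completeLatticeType d}.
Implicit Types (A : set L) (x y : L).

Lemma le_sup {A x} : A x -> x <= sup A.
Proof. by case: (sup_isLub A) => ub _; exact: ub. Qed.

Lemma sup_le {A y} : (forall x, A x -> x <= y) -> sup A <= y.
Proof. by case: (sup_isLub A) => _; apply. Qed.

(** The structure provides only arbitrary joins; a meet is the join of all lower bounds. *)
Definition inf A : L := sup (lbound A).

Lemma inf_le {A x} : A x -> inf A <= x.
Proof. by move=> Ax; apply: sup_le => y; apply. Qed.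

Lemma le_inf {A y} : (forall x, A x -> y <= x) -> y <= inf A.
Proof. by move=> yA; exact: le_sup. Qed.

Lemma not_le_inf {A y} : ~ y <= inf A -> exists2 x, A x & ~ y <= x.
Proof.
move=> yA; apply: contrapT => noA; apply: yA; apply: le_inf => x Ax.
by apply: contrapT => yx; apply: noA; exists x.
Qed.

Lemma sup2 x y : sup [set x; y] = x `|` y.
Proof.
apply/le_anti/andP; split.
  by apply: sup_le => z [->|->]; rewrite (leUl, leUr).
by rewrite leUx !le_sup //; [right|left].
Qed.

(** In a chain the join of two members is one of them. The list must be nonempty, since an empty
    join is [\bot], which may lie outside [A]. *)
Lemma chain_join_in A (s : seq L) :
  total_on A (fun x y => x <= y) -> s != [::] -> [set` s] `<=` A ->
  A (\join_(x <- s) x).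
Proof.
move=> Atot; elim: s => // x [|y s] IH _ sA.
  by rewrite big_seq1; apply: sA; rewrite /= inE.
have Ax : A x by apply: sA; rewrite /= inE eqxx.
have Aj : A (\join_(z <- y :: s) z).
  by apply: IH => // z /= zs; apply: sA; rewrite /= inE zs orbT.
by rewrite big_cons; case: (Atot _ _ Ax Aj) => [/join_r|/join_l] ->.
Qed.

End CompleteLattices.

Section MultiplicativeLattices.
Context {d : Order.disp_t} {L : multLatticeType d}.
Implicit Types (A : set L) (a b x y m : L).

Lemma mul_joinr x a b : x * (a `|` b) = (x * a) `|` (x * b).
Proof. by rewrite -!sup2 mul_supr image_setU !image_set1. Qed.

(** Distributing [x] over [\top = \top \join y] exhibits [x * y] as a joinand of [x]. *)
Lemma mul_le_l x y : x * y <= x.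
Proof.
have : x * y <= x * (\top `|` y) by rewrite mul_joinr leUr.
by rewrite join1x [x * \top]mulC mul1.
Qed.

Lemma maximal_z_prime {m} : maximal_element m -> z_prime m.
Proof.
move=> mmax; have [mproper mtop] := mmax; split=> // [a b eM bm|a b _ _ abm].
  (* Since [b <= m], the element [m] itself lies in [maximals_above b], hence in
     [maximals_above a]. *)
  have : maximals_above b m by [].
  by rewrite -eM => -[].
have [am|/negP am] := boolP (a <= m); [by left | right].
have maT : m `|` a = \top.
  apply: contrapT => maT; apply: am.
  by rewrite [leRHS](mtop (m `|` a)) ?leUl ?leUr // lt_neqAle lex1 andbT; apply/eqP.
(* Expand [b] as [b * (m \join a)], the join of [b * m] and [b * a], both below [m]. *)
by rewrite -(mul1 b) mulC -maT mul_joinr leUx [b * a]mulC abm mulC mul_le_l.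
Qed.

Lemma exists_maximal : (\bot : L) <> \top -> compact_element (\top : L) ->
  exists m : L, maximal_element m.
Proof.
move=> nontriv topc.
have [|||||m mproper mmax] := @Zorn_in L (fun x y => x <= y) (@proper_element d L).
- by exists \bot; apply/eqP.
- exact: lexx.
- exact: le_trans.
- exact: le_anti.
- move=> A A0 Aproper Atot; exists (sup A); last by move=> x; exact: le_sup.
  (* Compactness puts [\top] below a finite join of members of the chain; that join is itself a
     member, hence proper. *)
  apply/eqP => supT; have [|s [s0 sA]] := topc A A0; first by rewrite supT.
  by rewrite le1x; apply/negP; apply: Aproper; exact: chain_join_in.
by exists m; split=> // x mx xT; apply/esym/mmax => //; by rewrite /proper_element lt_eqF.
Qed.

Lemma z_element_inf {A} : (forall x, A x -> z_element x) -> z_element (inf A).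
Proof.
move=> Az a b eM bA; apply: le_inf => x Ax.
exact: (Az x Ax a b eM (le_trans bA (inf_le Ax))).
Qed.

Lemma z_prime_inf {A} : A !=set0 -> A `<=` @z_prime d L ->
  total_on A (fun x y => x <= y) -> z_prime (inf A).
Proof.
move=> [x0 Ax0] Ap Atot; split.
(* Nonemptiness matters here: the meet of the empty set is [\top]. *)
- have [x0proper _ _] := Ap _ Ax0; apply: contra x0proper => /eqP eT.
  by rewrite -le1x -eT inf_le.
- by apply: z_element_inf => x /Ap[].
move=> a b az bz abA; apply: contrapT => /not_orP[].
move=> /not_le_inf[p pA ap] /not_le_inf[q qA bq].
have [r rA [ar br]] : exists2 r, A r & ~ a <= r /\ ~ b <= r.
  have [pq|qp] := Atot _ _ pA qA.
    by exists p => //; split=> // bp; apply: bq; exact: le_trans pq.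
  by exists q => //; split=> // aq; apply: ap; exact: le_trans qp.
have [_ _ rprime] := Ap _ rA.
by case: (rprime a b az bz (le_trans abA (inf_le rA))).
Qed.

End MultiplicativeLattices.

Theorem proposition5p7 (d : Order.disp_t) (L : multLatticeType d)
    (L_nontrivial : (\bot : L) <> \top)
    (L_compactly_generated : compactly_generated L)
    (top_compact : compact_element (\top : L))
    (prod_compact : forall s : seq L,
        (forall x, x \in s -> compact_element x) ->
        compact_element (\prod_(x <- s) x)) :
  exists p : L, minimal_z_prime p.
Proof.
have [m mmax] := exists_maximal L_nontrivial top_compact.
(* For the reversed order, an upper bound of a chain is a lower bound and a maximal element is a
   minimal one. *)
have [|||||p pz pmin] := @Zorn_in L (fun x y => y <= x) (@z_prime d L).
- by exists m; exact: maximal_z_prime.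
- exact: lexx.
- exact: ge_trans.
- exact: ge_anti.
- move=> A A0 Az Atot; exists (inf A); last by move=> x; exact: inf_le.
  by apply: z_prime_inf => // x y Ax Ay; rewrite orC; exact: Atot.
by exists p.
Qed.
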